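(* For every $n\ge 1$, the path $P_n$ on $n$ vertices satisfies $\gamma^{p}_{I}(P_n)=\left\lceil\frac{n+1}{2}\right\rceil$.
   Context: All graphs are finite and simple. A perfect Italian dominating function (PID-function) of a graph $G$ is a function $f:V(G)\to\{0,1,2\}$ such that for every vertex $v$ with $f(v)=0$ we have $\sum_{u\in N(v)}f(u)=2$, where $N(v)$ is the open neighborhood of $v$. Its weight is $\sum_{u\in V(G)}f(u)$. The perfect Italian domination number $\gamma^{p}_{I}(G)$ is the minimum weight of a PID-function of $G$. *)

(* Defs.v *)
From mathcomp Require Import all_boot.

Set Implicit Arguments.
Unset Strict Implicit.
Unset Printing Implicit Defensive.

Record sgraph : Type := SGraph {
  vertex :> finType;
  adj : rel vertex;
  adj_sym : symmetric adj;
  adj_irrefl : irreflexive adj }.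

Definition neighborhood (G : sgraph) (v : G) : {set G} := [set u | adj v u].

Definition PID_function (G : sgraph) (f : {ffun G -> 'I_3}) : bool :=
  [forall v : G, (f v == 0 :> nat) ==> (\sum_(u in neighborhood v) f u == 2)].

Definition weight (G : sgraph) (f : {ffun G -> 'I_3}) : nat :=
  \sum_(u : G) f u.

Definition PID_weight (G : sgraph) (k : nat) : bool :=
  [exists f : {ffun G -> 'I_3}, PID_function f && (weight f == k)].

(* The constant function 2 is always a PID-function. *)
Lemma PID_weight_ex (G : sgraph) : exists k, PID_weight G k.
Proof.
exists (weight [ffun _ : G => ord_max : 'I_3]); apply/existsP.
exists [ffun _ : G => ord_max : 'I_3]; rewrite eqxx andbT.
by apply/forallP => v; rewrite ffunE.
Qed.

Definition PID_number (G : sgraph) : nat := ex_minn (PID_weight_ex G).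

Definition path_adj (n : nat) : rel 'I_n :=
  fun i j => (i.+1 == j :> nat) || (j.+1 == i :> nat).

Lemma path_adj_sym (n : nat) : symmetric (@path_adj n).
Proof. by move=> i j; rewrite /path_adj orbC. Qed.

Lemma path_adj_irrefl (n : nat) : irreflexive (@path_adj n).
Proof. by move=> i; rewrite /path_adj orbb; apply/negbTE; rewrite gtn_eqF. Qed.

Definition path_graph (n : nat) : sgraph :=
  SGraph (@path_adj_sym n) (@path_adj_irrefl n).

(* Main.v *)
Require Import Defs.
From mathcomp Require Import all_boot.
From mathcomp Require Import zify.

(** Pad a PID-function of [P_n] with zeros to a sequence
    [h 0 = 0, h 1, ..., h n, h (n + 1) = 0], so that the condition at a vertex
    of weight [0] reads [h (i - 1) + h (i + 1) = 2] everywhere. Scanning from the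
    left, the partial sums [S_k] satisfy [2 S_k >= k + h k] when [h k > 0] and
    [2 S_k + 1 >= k + h (k - 1)] when [h k = 0]; at [k = n] the condition at the
    last vertex turns this into [2 S_n >= n + 1]. The bound is attained by giving
    weight [1] to the vertices of even index [0, 2, ...] and to the last vertex. *)

(** For [m = 0] or [m > n] the sum is empty and [h m] vanishes, so the ends of the path need no
    separate treatment. *)
Lemma sum_ord_succ_eq (n m : nat) (h : nat -> nat) :
  h 0 = 0 -> (forall k, n < k -> h k = 0) ->
  \sum_(u < n | u.+1 == m) h u.+1 = h m.
Proof.
move=> h0 hbig; case: m => [|m]; first by rewrite big1.
case: (ltnP m n) => [lt_mn | le_nm].
  by rewrite (big_pred1 (Ordinal lt_mn)).
rewrite hbig // big1 // => u /eqP [um].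
by move: (ltn_ord u); rewrite um ltnNge le_nm.
Qed.

Lemma sum_path_neighborhood (n : nat) (f : {ffun path_graph n -> 'I_3})
    (h : nat -> nat) (v : 'I_n) :
  h 0 = 0 -> (forall k, n < k -> h k = 0) ->
  (forall u : 'I_n, f u = h u.+1 :> nat) ->
  \sum_(u in @neighborhood (path_graph n) v) f u = h v + h v.+2.
Proof.
move=> h0 hbig fh.
rewrite -(sum_ord_succ_eq n v h) // -(sum_ord_succ_eq n v.+2 h) //.
rewrite big_mkcond [in RHS]big_mkcond [X in _ = _ + X]big_mkcond -big_split /=.
apply: eq_bigr => u _; rewrite inE /= /path_adj fh eqSS [v.+1 == _]eq_sym.
(* [u = v + 1] and [u + 1 = v] exclude each other, so no term is counted twice. *)
by case: (u =P v.+1 :> nat) => [->|_]; rewrite ?addn0 // gtn_eqF.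
Qed.

Lemma prefix_sum_bound (n : nat) (h : nat -> nat) :
  h 0 = 0 -> (forall i, i < n -> h i.+1 = 0 -> h i + h i.+2 = 2) ->
  forall k, k < n ->
    k.+1 + (if h k.+1 == 0 then h k else (h k.+1).+1)
      <= (\sum_(i < k.+1) h i.+1).*2.+1.
Proof.
move=> h0 hP; elim=> [|k IH] lt_kn.
  by rewrite big_ord_recr big_ord0 /= h0; case: eqP; lia.
rewrite big_ord_recr /=; have := IH (ltnW lt_kn).
have := hP k (ltnW lt_kn); move: (\sum_(i < _) _) => S.
(* If [h k.+1 = 0], the condition turns the [h k] of the induction hypothesis into [2 - h k.+2];
   otherwise [h k.+1 >= 1] suffices. *)
by case: (h k.+1 =P 0) => [e /(_ e)|e _]; case: (h k.+2 =P 0); lia.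
Qed.

Lemma total_sum_bound (n : nat) (h : nat -> nat) :
  0 < n -> h 0 = 0 -> h n.+1 = 0 ->
  (forall i, i < n -> h i.+1 = 0 -> h i + h i.+2 = 2) ->
  n < (\sum_(i < n) h i.+1).*2.
Proof.
case: n => // n _ h0 hend hP.
have := prefix_sum_bound n.+1 h h0 hP n (ltnSn n); have := hP n (ltnSn n).
(* A last value [h n.+1 = 0] forces [h n = 2], since [h n.+2 = 0]. *)
by case: (h n.+1 =P 0) => [e /(_ e)|e _]; lia.
Qed.

Definition zero_pad {n : nat} (f : {ffun path_graph n -> 'I_3}) (k : nat) : nat :=
  if k is i.+1 then
    if @insub nat (fun j => j < n) 'I_n i is Some u then f u else 0
  else 0.

Lemma zero_pad_ord (n : nat) (f : {ffun path_graph n -> 'I_3}) (u : 'I_n) :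
  zero_pad f u.+1 = f u.
Proof. by rewrite /zero_pad valK. Qed.

Lemma zero_pad_big (n : nat) (f : {ffun path_graph n -> 'I_3}) (k : nat) :
  n < k -> zero_pad f k = 0.
Proof. by case: k => // k lt_nk; rewrite /zero_pad insubF // ltnNge -ltnS lt_nk. Qed.

Lemma path_PID_weight_ge (n : nat) (f : {ffun path_graph n -> 'I_3}) :
  0 < n -> PID_function f -> n < (weight f).*2.
Proof.
move=> n_gt0 /forallP fP.
have -> : weight f = \sum_(i < n) zero_pad f i.+1.
  by apply: eq_bigr => u _; rewrite zero_pad_ord.
apply: total_sum_bound => // [|i lt_in]; first exact: zero_pad_big.
move: (fP (Ordinal lt_in)).
rewrite (@sum_path_neighborhood n f (zero_pad f)) //; last first.
- by move=> u; rewrite zero_pad_ord.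
- exact: zero_pad_big.
by rewrite -zero_pad_ord /= => /implyP H /eqP /H /eqP.
Qed.

(** The last vertex gets weight 1 even at an odd index, since it has only one neighbour, of weight
    1. *)
Definition alternating (n : nat) : {ffun path_graph n -> 'I_3} :=
  [ffun u : 'I_n => inord (~~ odd u || (u.+1 == n))].

Lemma alternatingE (n : nat) (u : 'I_n) :
  alternating n u = ~~ odd u || (u.+1 == n) :> nat.
Proof. by rewrite ffunE inordK //; case: (_ || _). Qed.

Lemma alternating_PID (n : nat) : PID_function (alternating n).
Proof.
apply/forallP => v; apply/implyP.
pose h k := if k is i.+1 then (i < n) && (~~ odd i || (i.+1 == n)) : nat else 0.
rewrite (@sum_path_neighborhood n (alternating n) h) //; last first.
- by move=> u; rewrite alternatingE /h ltn_ord.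
- by case=> // k lt_nk; rewrite /h ltnNge -ltnS lt_nk.
rewrite alternatingE /h; case: v => -[|v] /= lt_vn; first by [].
(* A vertex [v.+1] of weight 0 is odd and not last, so [v] and [v.+2] are both even vertices of the
   path. *)
rewrite eqb0 negb_or !negbK => /andP[odd_v v_neq].
by rewrite odd_v (ltnW lt_vn) ltn_neqAle v_neq lt_vn.
Qed.

Lemma sum_even_ord (m : nat) : \sum_(i < m) ~~ odd i = uphalf m.
Proof. by elim: m => [|m IH]; rewrite ?big_ord0 // big_ord_recr /= IH; lia. Qed.

Lemma alternating_weight (n : nat) :
  0 < n -> weight (alternating n) = uphalf n.+1.
Proof.
case: n => // n _; rewrite /weight (eq_bigr _ (fun u _ => alternatingE n.+1 u)).
rewrite big_ord_recr /= eqxx orbT addn1 -sum_even_ord; congr _.+1.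
by apply: eq_bigr => i _; rewrite eqSS ltn_eqF ?orbF.
Qed.

Theorem theorem2p3 (n : nat) (hn : 1 <= n) :
  PID_number (path_graph n) = uphalf n.+1.
Proof.
rewrite /PID_number; case: ex_minnP => m /existsP[f /andP[fP /eqP <-]] min_f.
apply/eqP; rewrite eqn_leq; apply/andP; split.
  apply: min_f; apply/existsP; exists (alternating n).
  by rewrite alternating_PID alternating_weight //=.
(* [uphalf n.+1] is the least integer whose double exceeds [n]. *)
by have := path_PID_weight_ge n f hn fP; lia.
Qed.
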